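(* Let $f:\mathbb{R}\to\mathbb{R}$ be Lipschitz continuous, i.e. there is a real $K_1>0$ with $|f(u)-f(v)|\le K_1|u-v|$ for all $u,v\in\mathbb{R}$. Let $u_0:\mathbb{R}\to\mathbb{R}$ be a function that is bounded, $|u_0(x)|\le M$ for all $x\in\mathbb{R}$ for some real $M>0$, and Lipschitz continuous, $|u_0(x)-u_0(y)|\le L|x-y|$ for all $x,y\in\mathbb{R}$ for some real $L>0$. Then the initial value problem $$\frac{\partial u}{\partial t}=\frac{\partial^2u}{\partial x^2}+f(u)\quad (x\in\mathbb{R},\ t>0),\qquad u(x,0)=u_0(x),$$ has a weak solution.
   Context: A weak solution of the initial value problem $u_t=u_{xx}+f(u)$, $u(x,0)=u_0(x)$ is a continuous function $u:\mathbb{R}\times[0,\infty)\to\mathbb{R}$ such that $$\iint_{\mathbb{R}\times[0,\infty)}\bigl\{u(x,t)\,(-\varphi_{xx}(x,t)-\varphi_t(x,t))-f(u(x,t))\,\varphi(x,t)\bigr\}\,dx\,dt=\int_{\mathbb{R}}u_0(x)\,\varphi(x,0)\,dx$$ for all test functions $\varphi\in C_c^\infty(\mathbb{R}^2)$, i.e. all real-valued smooth compactly supported functions of $(x,t)\in\mathbb{R}^2$. *)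

(* Defs.v *)
From HB Require Import structures.
From mathcomp Require Import all_boot all_order all_algebra.
From mathcomp Require Import all_classical all_reals all_analysis.

Set Implicit Arguments.
Unset Strict Implicit.
Unset Printing Implicit Defensive.

Import Order.TTheory GRing.Theory Num.Theory.
Import numFieldNormedType.Exports.

Local Open Scope classical_set_scope.
Local Open Scope ring_scope.

(* A point of the plane is a pair z = (x, t): space first, time second. *)

Definition ddx {R : realType} (g : R * R -> R) : R * R -> R :=
  fun z => 'D_((1, 0) : R * R) g z.

Definition ddt {R : realType} (g : R * R -> R) : R * R -> R :=
  fun z => 'D_((0, 1) : R * R) g z.

(* C^n: every iterated partial derivative of order at most n (in any order of
   differentiation) exists everywhere and is continuous.  The existence has to
   be required explicitly, because 'D_v g z is total. *)
Fixpoint Cn {R : realType} (n : nat) (g : R * R -> R) : Prop :=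
  if n is m.+1 then
    [/\ continuous g,
        forall z, derivable g z ((1, 0) : R * R),
        forall z, derivable g z ((0, 1) : R * R),
        Cn m (ddx g) & Cn m (ddt g)]
  else continuous g.

Definition smooth {R : realType} (g : R * R -> R) : Prop :=
  forall n, Cn n g.

Definition compactly_supported {R : realType} (g : R * R -> R) : Prop :=
  compact (closure [set z | g z != 0]).

Definition test_function {R : realType} (g : R * R -> R) : Prop :=
  smooth g /\ compactly_supported g.

Definition half_plane {R : realType} : set (R * R) := [set z | 0 <= z.2].

(* Only the values of u on the closed half plane matter, and its continuity is
   continuity for the subspace topology.  For such u, continuous f and
   continuous u0, both integrands are bounded measurable with compact support,
   so the extended-real integrals below are finite. *)
Definition weak_solution {R : realType} (f u0 : R -> R) (u : R * R -> R)
    : Prop :=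
  {within half_plane, continuous u} /\
  forall phi : R * R -> R, test_function phi ->
    (\int[(@lebesgue_measure R \x @lebesgue_measure R)]_(z in half_plane)
        (u z * (- ddx (ddx phi) z - ddt phi z) - f (u z) * phi z)%:E
     = \int[@lebesgue_measure R]_x (u0 x * phi (x, 0))%:E)%E.

(* Main.v *)
(* Discretize time and keep [x] continuous. For [h > 0] and [k = h ^ 2 / 2] put
   [v_0 = u0] and [v_(m+1) x = (v_m (x + h) + v_m (x - h)) / 2 + k * f (v_m
   x)], and let [v (x, t)] be [v_m x] for [m = floor (t / k)]. Averaging
   preserves sup bounds and Lipschitz constants, and the reaction term makes
   them grow at most like [exp (K1 * t)]; comparison with a quadratic barrier
   bounds the oscillation in time. Hence the functions [v] are locally bounded
   and, up to an error that tends to 0 with [h], equicontinuous, so an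
   ultrafilter limit as [h] tends to 0 is continuous and locally uniform.
   Translation invariance of the Lebesgue measure turns the recursion into an
   exact weak identity in which the derivatives of the test function are
   replaced by difference quotients, and this identity passes to the limit. *)
Require Import Defs.
From mathcomp Require Import all_boot all_order all_algebra.
From mathcomp Require Import all_classical all_reals all_analysis.
From mathcomp Require Import measurable_realfun ring lra.
Import Order.TTheory GRing.Theory Num.Theory.
Import numFieldNormedType.Exports.
Local Open Scope classical_set_scope.
Local Open Scope ring_scope.

(** * The maximum norm of the plane *)

Lemma pair_norm_le (R : realType) (z : R * R) (r : R) :
  (`|z| <= r) = (`|z.1| <= r) && (`|z.2| <= r).
Proof. by rewrite prod_normE ge_max. Qed.

Lemma pair_dist_le (R : realType) (z z' : R * R) (r : R) :
  (`|z - z'| <= r) = (`|z.1 - z'.1| <= r) && (`|z.2 - z'.2| <= r).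
Proof. exact: pair_norm_le. Qed.

(** * The scheme *)

(** Explicit Euler in time with the centred second difference in space. At the ratio
    [k / h ^ 2 = 1 / 2], which is fixed in [approx], the value at the centre drops out of the
    diffusion part and a plain average remains. *)
Fixpoint scheme (R : realType) (f u0 : R -> R) (h k : R) (m : nat) (x : R) :=
 
  if m is m'.+1 then
    (scheme R f u0 h k m' (x + h) + scheme R f u0 h k m' (x - h)) / 2
    + k * f (scheme R f u0 h k m' x)
  else u0 x.
Arguments scheme {R} f u0 h k m x.

Section SchemeEstimates.
Context (R : realType) (f u0 : R -> R) (K1 M L : R).
Hypotheses (hK1 : 0 < K1) (hf : forall u v, `|f u - f v| <= K1 * `|u - v|).
Hypotheses (hM : forall x, `|u0 x| <= M).
Hypotheses (hL : forall x y, `|u0 x - u0 y| <= L * `|x - y|).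

(** This shift absorbs the constant [|f 0|], so that [a + |v|] obeys a purely multiplicative growth
    recursion. *)
Let a := `|f 0| / K1.

Lemma source_growth v : `|f v| <= K1 * (a + `|v|).
Proof.
have K1n0 : K1 != 0 by rewrite gt_eqF.
have -> : K1 * (a + `|v|) = `|f 0| + K1 * `|v| by rewrite /a; field.
have := hf v 0; rewrite subr0 => hv.
by rewrite -[f v](subrK (f 0)) addrC (le_trans (ler_normD _ _))// lerD2l.
Qed.

(** Discrete Gronwall inequality: averaging preserves a bound [B] on [a + |v|], and the source adds
    at most [k * K1 * B]. *)
Lemma scheme_bounded (h k : R) m x : 0 <= k ->
  a + `|scheme f u0 h k m x| <= (a + M) * (1 + k * K1) ^+ m.
Proof.
move=> k0; elim: m x => [|m IH] x; first by rewrite expr0 mulr1 lerD2l.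
rewrite exprSr mulrA [scheme _ _ _ _ _ _]/=.
set s := scheme _ _ _ _ _ in IH *; set B := _ * _ in IH *.
have := IH (x + h); have := IH (x - h); have := IH x.
have := source_growth (s x).
move=> fs sx sm sp.
have kfs : `|k * f (s x)| <= k * (K1 * B).
  rewrite normrM ger0_norm// ler_wpM2l// (le_trans fs)// ler_wpM2l//.
  exact: ltW.
have avg : `|(s (x + h) + s (x - h)) / 2| <= B - a.
  rewrite normrM [`|2^-1|]gtr0_norm ?invr_gt0//.
  have := ler_normD (s (x + h)) (s (x - h)); lra.
have := ler_normD ((s (x + h) + s (x - h)) / 2) (k * f (s x)).
lra.
Qed.

(** Averaging commutes with translations, so differences between two points follow the same kind of
    recursion, with a source at most [K1] times the current difference. *)
Lemma scheme_lipschitz (h k : R) m x y : 0 <= k ->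
  `|scheme f u0 h k m x - scheme f u0 h k m y|
    <= L * (1 + k * K1) ^+ m * `|x - y|.
Proof.
move=> k0; elim: m x y => [|m IH] x y; first by rewrite expr0 mulr1.
rewrite exprSr mulrA [scheme _ _ _ _ _ x]/= [scheme _ _ _ _ _ y]/=.
set s := scheme _ _ _ _ _ in IH *; set B := _ * _ in IH *.
have := IH (x + h) (y + h); have := IH (x - h) (y - h); have := IH x y.
have -> : x + h - (y + h) = x - y by ring.
have -> : x - h - (y - h) = x - y by ring.
move=> sx sm sp.
have kfs : `|k * (f (s x) - f (s y))| <= k * (K1 * (B * `|x - y|)).
  rewrite normrM ger0_norm// ler_wpM2l// (le_trans (hf _ _))// ler_wpM2l//.
  exact: ltW.
have avg : `|((s (x + h) - s (y + h)) + (s (x - h) - s (y - h))) / 2|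
    <= B * `|x - y|.
  rewrite normrM [`|2^-1|]gtr0_norm ?invr_gt0//.
  have := ler_normD (s (x + h) - s (y + h)) (s (x - h) - s (y - h)); lra.
have -> : (s (x + h) + s (x - h)) / 2 + k * f (s x)
    - ((s (y + h) + s (y - h)) / 2 + k * f (s y))
    = ((s (x + h) - s (y + h)) + (s (x - h) - s (y - h))) / 2
      + k * (f (s x) - f (s y)) by field.
have := ler_normD (((s (x + h) - s (y + h)) + (s (x - h) - s (y - h))) / 2)
  (k * (f (s x) - f (s y))).
lra.
Qed.

(* The quadratic barrier works because averaging [y |-> (y - x) ^ 2] over
   [y + h] and [y - h] adds exactly [h ^ 2]; at [y = x] it gives a modulus of
   continuity in time that is uniform in [h]. *)
Lemma scheme_barrier (h k d Lam F : R) m j x y : 0 <= k -> 0 < d ->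
  (forall y z, `|scheme f u0 h k m y - scheme f u0 h k m z| <= Lam * `|y - z|) ->
  (forall i y, (i < j)%N -> `|f (scheme f u0 h k (m + i) y)| <= F) ->
  `|scheme f u0 h k (m + j) y - scheme f u0 h k m x|
    <= Lam * (((y - x) ^+ 2 + j%:R * h ^+ 2) / (2 * d) + d / 2)
       + j%:R * (k * F).
Proof.
move=> k0 d0 lip; have dn0 : d != 0 by rewrite gt_eqF.
have Lam0 : 0 <= Lam.
  by have := lip 1 0; rewrite subr0 normr1 mulr1; apply: le_trans.
elim: j y => [|j IH] y hF.
  rewrite addn0 !mul0r !addr0 (le_trans (lip _ _))// ler_wpM2l//.
  rewrite -[(y - x) ^+ 2]real_normK ?num_real//; set e := `|y - x|.
  rewrite -subr_ge0.
  (* The cone [e = |y - x|] lies below the parabola [e ^ 2 / (2 * d) + d / 2], which touches it at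
     [e = d]; this starts the induction for every [d]. *)
  have -> : e ^+ 2 / (2 * d) + d / 2 - e = (e - d) ^+ 2 / (2 * d) by field.
  by rewrite divr_ge0 ?sqr_ge0// mulr_ge0// ltW.
have {}IH y' : _ := IH y' (fun i y ij => hF i y (ltnW ij)).
have := IH (y + h); have := IH (y - h); have := hF j y (ltnSn j).
rewrite addnS [scheme _ _ _ _ (m + j).+1 _]/=.
set s := scheme f u0 h k (m + j); set c := scheme _ _ _ _ _ _.
set Bm := Lam * _; set Bp := Lam * _; set B := Lam * _.
move=> fs sm sp.
have BE : B = (Bm + Bp) / 2 by rewrite /B /Bm /Bp -natr1; field.
have kfs : `|k * f (s y)| <= k * F by rewrite normrM ger0_norm// ler_wpM2l.
have avg : `|((s (y + h) - c) + (s (y - h) - c)) / 2| <= B + j%:R * (k * F).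
  rewrite normrM [`|2^-1|]gtr0_norm ?invr_gt0//.
  have := ler_normD (s (y + h) - c) (s (y - h) - c); lra.
have -> : (s (y + h) + s (y - h)) / 2 + k * f (s y) - c
    = ((s (y + h) - c) + (s (y - h) - c)) / 2 + k * f (s y) by field.
have := ler_normD (((s (y + h) - c) + (s (y - h) - c)) / 2) (k * f (s y)).
rewrite -natr1; lra.
Qed.

(* [truncn] sends negative reals to 0, so [approx h (x, t) = u0 x] for [t < 0]:
   the limit is continuous on the whole plane, not only on the half plane. *)
Definition approx (h : R) (z : R * R) : R :=
  scheme f u0 h (h ^+ 2 / 2) (Num.truncn (z.2 / (h ^+ 2 / 2))) z.1.

(** The [1] is the loss from rounding; after scaling by [k] it becomes the extra time step
    [h ^ 2 / 2] in [approx_modulus_time]. *)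
Lemma truncn_le_add (x y : R) :
  (Num.truncn x)%:R <= (Num.truncn y)%:R + (`|x - y| + 1).
Proof.
have := truncnS_gt y; rewrite -natr1 => yt.
have := ler_norm (x - y) => xy.
have [x1|x1] := leP 1 x.
  have : (Num.truncn x)%:R <= x by rewrite truncn_le (le_trans ler01).
  lra.
have -> : Num.truncn x = 0%N by apply/truncn0Pn; rewrite -ltNge.
by rewrite !addr_ge0// ler0n.
Qed.

Lemma truncn_step_le (k t T : R) : 0 < k -> 0 <= T -> t <= T ->
  (Num.truncn (t / k))%:R * k <= T.
Proof.
(* The case [t / k < 1] includes negative [t]; the truncation is then 0 and [0 <= T] suffices. *)
move=> k0 T0 tT; have [x1|x1] := leP 1 (t / k); last first.
  have -> : Num.truncn (t / k) = 0%N by apply/truncn0Pn; rewrite -ltNge.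
  by rewrite mul0r.
rewrite (le_trans _ tT)// -ler_pdivlMr// truncn_le.
exact: le_trans ler01 x1.
Qed.

(** By [1 + x <= exp x]; this makes the growth factors of the scheme independent of the step
    size. *)
Lemma compound_le_expR (k T : R) m : 0 <= k -> m%:R * k <= T ->
  (1 + k * K1) ^+ m <= expR (K1 * T).
Proof.
move=> k0 mkT; apply: (@le_trans _ _ (expR (k * K1) ^+ m)).
  rewrite lerXn2r ?nnegrE ?expR_ge0//; last exact: expR_ge1Dx.
  by rewrite addr_ge0// mulr_ge0// ltW.
rewrite -expRM_natl ler_expR mulrC -mulrA mulrC -mulrA.
by rewrite ler_pM2l.
Qed.

Let aM0 : 0 <= a + M.
Proof.
by rewrite addr_ge0 ?(le_trans _ (hM 0))// divr_ge0// ltW.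
Qed.

Let L0 : 0 <= L.
Proof. by have := hL 1 0; rewrite subr0 normr1 mulr1; apply: le_trans. Qed.

(** The value at time [T] of the solution of [y' = K1 * y] with [y 0 = a + M]. *)
Definition sup_bound (T : R) : R := (a + M) * expR (K1 * T).

Lemma approx_bounded (h T : R) z : 0 < h -> 0 <= T -> z.2 <= T ->
  a + `|approx h z| <= sup_bound T.
Proof.
move=> h0 T0 zT; have k0 : 0 < h ^+ 2 / 2 by rewrite divr_gt0 ?exprn_gt0.
apply: (le_trans (scheme_bounded _ _ _ _ (ltW k0))).
rewrite ler_wpM2l//; apply: compound_le_expR (ltW k0) _.
exact: truncn_step_le.
Qed.

Lemma approx_lipschitz_space (h T t x y : R) : 0 < h -> 0 <= T -> t <= T ->
  `|approx h (x, t) - approx h (y, t)| <= L * expR (K1 * T) * `|x - y|.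
Proof.
move=> h0 T0 tT; have k0 : 0 < h ^+ 2 / 2 by rewrite divr_gt0 ?exprn_gt0.
apply: (le_trans (scheme_lipschitz _ _ _ _ _ (ltW k0))).
rewrite ler_wpM2r// ler_wpM2l//; apply: compound_le_expR (ltW k0) _.
exact: truncn_step_le.
Qed.

(** The barrier is applied between the two time levels, at a fixed point of space. Taking [d] near
    the square root of the time gap would give a Hölder exponent 1/2; [d] stays free because
    equicontinuity is enough. *)
Lemma approx_modulus_time (h d T s t x : R) :
  0 < h -> 0 < d -> 0 <= T -> s <= T -> t <= T ->
  `|approx h (x, t) - approx h (x, s)| <=
     L * expR (K1 * T) * ((`|t - s| + h ^+ 2 / 2) / d + d / 2)
     + (`|t - s| + h ^+ 2 / 2) * (K1 * sup_bound T).
Proof.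
move=> h0 d0 T0; have k0 : 0 < h ^+ 2 / 2 by rewrite divr_gt0 ?exprn_gt0.
wlog st : s t / s <= t => [H|sT tT].
  have [st|/ltW ts] := leP s t; first exact: H.
  by move=> sT tT; rewrite distrC (distrC t); apply: H.
rewrite /approx/=; set k := h ^+ 2 / 2 in k0 *.
set m := Num.truncn (s / k); set n := Num.truncn (t / k).
have mn : (m <= n)%N by apply: le_truncn; rewrite ler_pM2r ?invr_gt0.
have nT : n%:R * k <= T by exact: truncn_step_le.
have step i : (i <= n)%N -> (1 + k * K1) ^+ i <= expR (K1 * T).
  move=> ni; apply: compound_le_expR (ltW k0) _; apply: le_trans nT.
  by rewrite ler_wpM2r ?ler_nat// ltW.
have lip y z : `|scheme f u0 h k m y - scheme f u0 h k m z|
    <= L * expR (K1 * T) * `|y - z|.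
  apply: (le_trans (scheme_lipschitz _ _ _ _ _ (ltW k0))).
  by rewrite ler_wpM2r// ler_wpM2l//; apply: step.
have src i y : (i < n - m)%N ->
    `|f (scheme f u0 h k (m + i) y)| <= K1 * sup_bound T.
  move=> inm; apply: (le_trans (source_growth _)); rewrite ler_pM2l//.
  apply: (le_trans (scheme_bounded _ _ _ _ (ltW k0))).
  by rewrite ler_wpM2l//; apply: step; rewrite -leq_subRL// ltnW.
have := scheme_barrier _ _ d _ _ m (n - m) x x (ltW k0) d0 lip src.
rewrite subnKC// subrr expr0n add0r => /le_trans; apply.
have jk : (n - m)%:R * k <= `|t - s| + k.
  rewrite natrB// -ler_pdivlMr// lerBlDl.
  have := truncn_le_add (t / k) (s / k).
  rewrite -mulrBl normrM normfV (gtr0_norm k0) mulrDl divff ?gt_eqF//.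
have hk : h ^+ 2 = 2 * k by rewrite /k; field.
have -> : (n - m)%:R * h ^+ 2 / (2 * d) = (n - m)%:R * k / d.
  by rewrite hk; field; rewrite gt_eqF.
have F0 : 0 <= K1 * sup_bound T.
  by rewrite mulr_ge0 ?(ltW hK1)// mulr_ge0 ?expR_ge0.
rewrite mulrA lerD// ?ler_wpM2r//.
rewrite ler_wpM2l ?mulr_ge0 ?expR_ge0// lerD2r ler_wpM2r//.
by rewrite invr_ge0 ltW.
Qed.

(** Each [approx h] jumps at its time levels, so equicontinuity can hold only for time steps below
    the threshold [r], which depends on [e]. *)
Lemma approx_equicontinuous z0 (e : R) : 0 < e -> exists2 r : R, 0 < r &
  forall h z, 0 < h -> h ^+ 2 / 2 <= r -> `|z - z0| <= r ->
    `|approx h z - approx h z0| <= e.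
Proof.
case: z0 => x0 t0 e0; pose T := `|(x0, t0)| + 1.
have T0 : 0 <= T by rewrite addr_ge0.
pose Lam := L * expR (K1 * T); pose F := K1 * sup_bound T.
have Lam0 : 0 <= Lam by rewrite mulr_ge0 ?expR_ge0.
have F0 : 0 <= F.
  by rewrite mulr_ge0 ?(ltW hK1)// mulr_ge0 ?expR_ge0.
pose W := Lam + F + 1; have W0 : 0 < W by rewrite ltr_wpDl// addr_ge0.
(* This [d] makes the barrier term [W * (d / 2)] equal to [e / 2]. The other terms add up to
   [W * (r * c)], and the choice of [r] keeps them below [e / 2]. *)
pose d := e / W; have d0 : 0 < d by rewrite divr_gt0.
pose c := 3 + 2 / d; have c0 : 0 < c by rewrite addr_gt0// divr_gt0.
pose r := Num.min 1 (e / (2 * W * c)).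
have r0 : 0 < r by rewrite lt_min ltr01 divr_gt0// !mulr_gt0.
have rc : W * (r * c) <= e / 2.
  have : r <= e / (2 * W * c) by rewrite ge_min lexx orbT.
  rewrite ler_pdivlMr ?mulr_gt0//; lra.
exists r => // h [x t] h0 kr; rewrite pair_dist_le/= => /andP[xr tr].
have /andP[_ /= z0t] :
    (`|(x0, t0).1| <= `|(x0, t0)|) && (`|(x0, t0).2| <= `|(x0, t0)|).
  by rewrite -pair_norm_le.
have t0T : t0 <= T.
  by have := ler_norm t0; rewrite /T; lra.
have tT : t <= T.
  have : r <= 1 by rewrite ge_min lexx.
  by have := ler_norm t0; have := ler_norm (t - t0); rewrite /T; lra.
have A := approx_lipschitz_space _ T t x x0 h0 T0 tT.
have B := approx_modulus_time _ d T t0 t x0 h0 d0 T0 t0T tT.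
rewrite -/Lam -/F in A B.
have {}A : `|approx h (x, t) - approx h (x0, t)| <= W * r.
  apply: (le_trans A); apply: ler_pM => //; rewrite /W; lra.
have {}B : `|approx h (x0, t) - approx h (x0, t0)|
    <= W * (2 * r / d) + W * (d / 2) + W * (2 * r).
  have tk : `|t - t0| + h ^+ 2 / 2 <= 2 * r by lra.
  have tk0 : 0 <= `|t - t0| + h ^+ 2 / 2.
    by rewrite addr_ge0// divr_ge0// exprn_ge0// ltW.
  apply: (le_trans B); rewrite -mulrDr [X in _ + X]mulrC.
  have LW : Lam <= W by rewrite /W; lra.
  have FW : F <= W by rewrite /W; lra.
  apply: lerD; apply: ler_pM => //.
    by rewrite addr_ge0// divr_ge0// ltW.
  by rewrite lerD2r ler_pM2r ?invr_gt0.
have WE : W * (d / 2) = e / 2 by rewrite /d; field; rewrite gt_eqF.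
have cE : W * (r * c) = W * (2 * r / d) + W * (2 * r) + W * r.
  by rewrite /c; field; rewrite gt_eqF.
have -> : approx h (x, t) - approx h (x0, t0) =
  (approx h (x, t) - approx h (x0, t)) +
  (approx h (x0, t) - approx h (x0, t0)) by ring.
apply: (le_trans (ler_normD _ _)); lra.
Qed.

End SchemeEstimates.

Arguments approx {R} f u0 h z.
Arguments sup_bound {R} f K1 M T.

(** * Integration in the plane *)

Section PlaneMeasurability.
Context {R : realType}.

(** Measurability refers to the product sigma-algebra. An open set is the union of the rational
    boxes inside it, and there are countably many of these. *)
Lemma open_measurable_plane (A : set (R * R)) : open A -> measurable A.
Proof.
move=> oA.
pose box (q : (rat * rat) * (rat * rat)) : set (R * R) :=
  `]ratr q.1.1, ratr q.1.2[%classic `*` `]ratr q.2.1, ratr q.2.2[%classic.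
(* Boxes that leave [A] are replaced by the empty set, so the union runs over all rational
   quadruples, a countable type. *)
pose F q := if `[< box q `<=` A >] then box q else set0.
have -> : A = \bigcup_q F q.
  apply/seteqP; split=> [[x t] Axt|z [q _]]; last first.
    by rewrite /F; case: asboolP => // qA /qA.
  have /nbhs_ballP[e /= e0 eA] : nbhs (x, t) A by apply: open_nbhs_nbhs.
  have [a] := @rat_in_itvoo R (x - e) x ltac:(lra).
  rewrite in_itv/= => /andP[a1 a2].
  have [b] := @rat_in_itvoo R x (x + e) ltac:(lra).
  rewrite in_itv/= => /andP[b1 b2].
  have [c] := @rat_in_itvoo R (t - e) t ltac:(lra).
  rewrite in_itv/= => /andP[c1 c2].
  have [d] := @rat_in_itvoo R t (t + e) ltac:(lra).
  rewrite in_itv/= => /andP[d1 d2].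
  exists ((a, b), (c, d)) => //; rewrite /F asboolT.
    by split=> /=; rewrite in_itv/= ?a2 ?b1 ?c2 ?d1.
  move=> [y s] [] /=; rewrite !in_itv/= => /andP[y1 y2] /andP[s1 s2].
  apply: eA; split => /=; rewrite /ball/= ltr_norml.
    by apply/andP; split; lra.
  by apply/andP; split; lra.
apply: countable_bigcupT_measurable => // q; rewrite /F; case: asboolP => // _.
by apply: measurableX; exact: measurable_itv.
Qed.

Lemma continuous_measurable_plane (g : R * R -> R) :
  continuous g -> measurable_fun setT g.
Proof.
move=> /continuousP cg; apply: (measurability _ (RGenOpens.measurableE R)).
move=> _ [_ [a [b ->] <-]]; rewrite setTI; apply: open_measurable_plane.
exact/cg/interval_open.
Qed.

End PlaneMeasurability.

(** * Translation invariance of the Lebesgue measure on the line and on the plane *)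

Section TranslationInvariance.
Context {R : realType}.
Local Notation mu := (@lebesgue_measure R).
Local Notation mu2 := (mu \x mu)%E.

Lemma measurable_translation (c : R) :
  measurable_fun [set: measurableTypeR R] (fun x : R => x + c).
Proof.
apply: (@continuous_measurable_fun R) => x.
by apply: cvgD; [exact: cvg_id|exact: cvg_cst].
Qed.

(** By uniqueness of the Lebesgue measure it suffices to compare the two measures on half-open
    intervals. *)
Lemma lebesgue_measure_translation (c : R) (A : set R) : measurable A ->
  pushforward mu (fun x : measurableTypeR R => x + c : measurableTypeR R) A
  = mu A.
Proof.
move=> mA; apply/esym.
have mc := measurable_translation c.
apply: (@lebesgue_measure_unique R
  (pushforward mu (fun x : measurableTypeR R => x + c : measurableTypeR R))) => //=.
move=> _ [[a b]] _ <-.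
rewrite [RHS](_ : _ = mu `](a - c), (b - c)]%classic); last first.
  rewrite /pushforward; congr (mu _); apply/seteqP; split => x /=;
  by rewrite !in_itv/= ltrBlDr lerBrDr.
rewrite !lebesgue_measure_itv/= !lte_fin ltrD2r.
by case: ifP => //= _; rewrite -!EFinB; congr (_%:E); ring.
Qed.

Definition translate (c : R * R) (z : R * R) : R * R := (z.1 + c.1, z.2 + c.2).

Lemma measurable_translate (c : R * R) :
  measurable_fun setT (translate c
    : measurableTypeR R * measurableTypeR R -> measurableTypeR R * measurableTypeR R).
Proof.
apply: measurable_fun_pair => /=.
  exact: (measurableT_comp (measurable_translation c.1) measurable_fst).
exact: (measurableT_comp (measurable_translation c.2) measurable_snd).
Qed.

(** By uniqueness of the product measure it suffices to look at rectangles, where the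
    one-dimensional result applies to each side. *)
Lemma product_measure_translate (c : R * R) (A : set (R * R)) : measurable A ->
  pushforward mu2 (translate c) A = mu2 A.
Proof.
move=> mA; apply/esym; have mc := measurable_translate c.
pose T2 := (measurableTypeR R * measurableTypeR R)%type.
apply: (product_measure_unique (m1 := mu) (m2 := mu)
  (m' := pushforward mu2 (translate c : T2 -> T2))) => //.
move=> B C mB mC; have mt := measurable_translation.
have preim (d : R) (D : set R) : measurable D ->
    measurable ((fun x : R => x + d) @^-1` D).
  by move=> mD; rewrite -[X in measurable X]setTI; exact: mt.
transitivity (mu ((fun x : R => x + c.1)%R @^-1` B)
  * mu ((fun x : R => x + c.2)%R @^-1` C))%E.
  by apply: (@product_measure1E _ _ _ _ _ mu mu); exact: preim.
by congr (_ * _)%E; exact: lebesgue_measure_translation.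
Qed.

End TranslationInvariance.

(** * Locally bounded functions, and integration of those with bounded support *)

Section LocallyBounded.
Context {R : realType}.
Local Notation mu := (@lebesgue_measure R).
Local Notation mu2 := (mu \x mu)%E.
Implicit Types (w g : R * R -> R).

(** A class closed under sums, products, translations and composition with continuous functions. The
    [boxed] functions form an ideal in it and are integrable, so integrability below follows from
    the shape of each integrand. *)
Definition loc_bounded w := measurable_fun setT w /\
  forall X : R, exists C : R, forall z, `|z| <= X -> `|w z| <= C.

Definition boxed g := loc_bounded g /\
  exists X : R, forall z, X < `|z| -> g z = 0.

Lemma loc_boundedD w1 w2 :
  loc_bounded w1 -> loc_bounded w2 -> loc_bounded (fun z => w1 z + w2 z).
Proof.
move=> [m1 b1] [m2 b2]; split; first exact: measurable_funD.
move=> X; have [C1 h1] := b1 X; have [C2 h2] := b2 X.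
exists (C1 + C2) => z zX; rewrite (le_trans (ler_normD _ _))//.
by rewrite lerD ?h1 ?h2.
Qed.

Lemma loc_boundedM w1 w2 :
  loc_bounded w1 -> loc_bounded w2 -> loc_bounded (fun z => w1 z * w2 z).
Proof.
move=> [m1 b1] [m2 b2]; split; first exact: measurable_funM.
move=> X; have [C1 h1] := b1 X; have [C2 h2] := b2 X.
exists (C1 * C2) => z zX; rewrite normrM.
by apply: ler_pM => //; [exact: h1|exact: h2].
Qed.

Lemma loc_bounded_cst (c : R) : loc_bounded (fun=> c).
Proof. by split; [exact: measurable_cst|move=> X; exists `|c|]. Qed.

Lemma loc_boundedN w : loc_bounded w -> loc_bounded (fun z => - w z).
Proof.
move=> bw; have := loc_boundedM _ _ (loc_bounded_cst (-1)) bw.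
by under eq_fun do rewrite mulN1r.
Qed.

Lemma loc_boundedB w1 w2 :
  loc_bounded w1 -> loc_bounded w2 -> loc_bounded (fun z => w1 z - w2 z).
Proof. by move=> b1 b2; apply/loc_boundedD => //; exact: loc_boundedN. Qed.

Lemma loc_bounded_translate c w :
  loc_bounded w -> loc_bounded (fun z => w (translate c z)).
Proof.
move=> [mw bw]; split.
  by apply: (measurableT_comp (f := w)) => //; exact: measurable_translate.
move=> X; have [C h] := bw (X + `|c|); exists C => z zX; apply: h.
by rewrite (le_trans (ler_normD _ _))// lerD.
Qed.

Lemma loc_bounded_comp (F : R -> R) w : continuous F ->
  loc_bounded w -> loc_bounded (fun z => F (w z)).
Proof.
move=> cF [mw bw]; split.
  by apply: (measurableT_comp (f := F)) => //; exact: continuous_measurable_fun.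
move=> X; have [C h] := bw X.
have : compact (F @` `[- C, C]%classic).
  apply: continuous_compact; last exact: segment_compact.
  exact: continuous_subspaceT.
move=> /compact_bounded[N [_ bN]]; exists (N + 1) => z zX.
apply: (bN (N + 1)); first by rewrite ltrDl.
by exists (w z) => //=; rewrite in_itv/= -ler_norml h.
Qed.

Lemma compact_ball_plane (X : R) : compact [set z : R * R | `|z| <= X].
Proof.
have -> : [set z : R * R | `|z| <= X]
    = `[- X, X]%classic `*` `[- X, X]%classic.
  apply/seteqP; split=> -[x t] /=; rewrite pair_norm_le/= !in_itv/= -!ler_norml.
    by move=> /andP.
  by move=> [-> ->].
by apply: compact_setX; exact: segment_compact.
Qed.

Lemma loc_bounded_continuous w : continuous w -> loc_bounded w.
Proof.
move=> cw; split; first exact: continuous_measurable_plane.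
move=> X; have : compact (w @` [set z | `|z| <= X]).
  apply: continuous_compact; last exact: compact_ball_plane.
  exact: continuous_subspaceT.
move=> /compact_bounded[N [_ bN]]; exists (N + 1) => z zX.
by apply: (bN (N + 1)); [rewrite ltrDl|exists z].
Qed.

Lemma boxedM w g : loc_bounded w -> boxed g -> boxed (fun z => w z * g z).
Proof.
move=> bw [bg [X g0]]; split; first exact: loc_boundedM.
by exists X => z /g0 ->; rewrite mulr0.
Qed.

Lemma boxedD g1 g2 : boxed g1 -> boxed g2 -> boxed (fun z => g1 z + g2 z).
Proof.
move=> [b1 [X1 h1]] [b2 [X2 h2]]; split; first exact: loc_boundedD.
exists (Num.max X1 X2) => z; rewrite gt_max => /andP[z1 z2].
by rewrite h1// h2// addr0.
Qed.

Lemma boxedZ c g : boxed g -> boxed (fun z => c * g z).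
Proof. by apply: boxedM; exact: loc_bounded_cst. Qed.

Lemma boxedB g1 g2 : boxed g1 -> boxed g2 -> boxed (fun z => g1 z - g2 z).
Proof.
move=> b1 /(boxedZ (-1)) b2; have := boxedD _ _ b1 b2.
by under eq_fun do rewrite mulN1r.
Qed.

Lemma boxed_translate c g : boxed g -> boxed (fun z => g (translate c z)).
Proof.
move=> [bg [X g0]]; split; first exact: loc_bounded_translate.
exists (X + `|c|) => z zX; apply: g0.
have : `|z| <= `|translate c z| + `|c|.
  have {1}-> : z = translate c z - c.
    by case: z c {zX} => [x t] [a b]; rewrite /translate/=; congr pair => /=; ring.
  by rewrite (le_trans (ler_normB _ _)).
lra.
Qed.

Lemma lebesgue_measure_segment (a b : R) : a <= b ->
  mu `[a, b]%classic = (b - a)%:E.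
Proof.
move=> ab; rewrite [LHS]lebesgue_measure_itv/= lte_fin -EFinB.
case: ltgtP ab => //= -> _; by rewrite subrr.
Qed.

Lemma lebesgue_measure_rectangle (a b c d : R) : a <= b -> c <= d ->
  mu2 (`[a, b]%classic `*` `[c, d]%classic) = ((b - a) * (d - c))%:E.
Proof.
move=> ab cd; transitivity (mu `[a, b]%classic * mu `[c, d]%classic)%E.
  by apply: (@product_measure1E _ _ _ _ _ mu mu); exact: measurable_itv.
by rewrite !lebesgue_measure_segment// EFinM.
Qed.

Lemma boxed_integrable g : boxed g -> mu2.-integrable setT (EFin \o g).
Proof.
move=> [[mg bg] [X g0]]; have [C gC] := bg X.
pose D : set (R * R) := `[- X, X]%classic `*` `[- X, X]%classic.
have mD : measurable D by apply: measurableX; exact: measurable_itv.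
have -> : EFin \o g = (EFin \o g) \_ D.
  apply/funext => z; rewrite patchE; case: ifPn => // /negP zD /=.
  rewrite g0// ltNge; apply/negP; rewrite pair_norm_le => /andP[z1 z2].
  by apply: zD; rewrite inE; split; rewrite /= in_itv/= -ler_norml.
apply: (@integrable_mkcond _ _ _ mu2 D (EFin \o g) mD).1.
have muD : (mu2 D < +oo)%E.
  (* Nothing forces [X] to be nonnegative; for negative [X] the square is empty. *)
  have [X0|X0] := leP 0 X; last first.
    by rewrite /D set_itv_ge ?set0X ?measure0// bnd_simp; lra.
  rewrite [X in (X < _)%E](_ : _ = ((X - - X) * (X - - X))%:E) ?ltry//.
  by apply: lebesgue_measure_rectangle; lra.
apply: (@measurable_bounded_integrable _ _ _ mu2 g D mD muD).
- exact: measurable_funTS.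
- exists C; split; first by rewrite num_real.
  move=> N CN z [/=]; rewrite !in_itv/= -!ler_norml => z1 z2.
  by rewrite (le_trans _ (ltW CN))// gC// pair_norm_le z1.
Qed.

Lemma integral_translate c g : boxed g ->
  \int[mu2]_z g (translate c z) = \int[mu2]_z g z.
Proof.
move=> bg; congr fine; have mt := measurable_translate c.
have [[mg _] _] := bg.
pose T2 := (measurableTypeR R * measurableTypeR R)%type.
have mEg : measurable_fun [set: T2] (EFin \o g) by exact/measurable_EFinP.
have ig : mu2.-integrable (translate c @^-1` setT) ((EFin \o g) \o translate c).
  exact: (boxed_integrable (fun z => g (translate c z)) (boxed_translate c g bg)).
have E := @integral_pushforward _ _ T2 T2 R (translate c) mt mu2 setT
  (EFin \o g) mEg ig measurableT.
apply: (etrans (esym E)).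
apply: eq_measure_integral => A mA _; exact: product_measure_translate.
Qed.

(** The form in which translation invariance enters the summation by parts. *)
Lemma integral_sub_translate c g : boxed g ->
  \int[mu2]_z (g z - g (translate c z)) = 0.
Proof.
move=> bg; rewrite RintegralB//; last 2 first.
- exact: boxed_integrable.
- by apply: boxed_integrable; exact: boxed_translate.
by rewrite integral_translate// subrr.
Qed.

(** The two sides of the rectangle are independent because the initial layer has height only [k],
    and this factor must survive in the bound. *)
Lemma le_norm_integral_rectangle (a b c d C : R) g : a <= b -> c <= d ->
  boxed g -> (forall z, `|g z| <= C) ->
  (forall z, g z != 0 -> a <= z.1 <= b /\ c <= z.2 <= d) ->
  `|\int[mu2]_z g z| <= C * ((b - a) * (d - c)).
Proof.
move=> ab cd bg gC gD.
pose D : set (R * R) := `[a, b]%classic `*` `[c, d]%classic.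
have mD : measurable D by apply: measurableX; exact: measurable_itv.
have ig := boxed_integrable g bg.
have igD : mu2.-integrable D (EFin \o g) by apply: integrableS ig.
have muD : mu2 D = ((b - a) * (d - c))%:E by exact: lebesgue_measure_rectangle.
have -> : \int[mu2]_z g z = \int[mu2]_(z in D) g z.
  rewrite [RHS]Rintegral_mkcond; congr (Rintegral _ _ _); apply/funext => z.
  rewrite patchE; case: ifPn => // /negP zD; apply/eqP/negPn/negP => /gD[z1 z2].
  by apply: zD; rewrite inE; split; rewrite /= in_itv.
have A := @le_normr_Rintegral _ _ _ mu2 D g mD igD.
apply: (le_trans A).
have muC : \int[mu2]_(z in D) C = C * ((b - a) * (d - c)).
  transitivity (C * fine (mu2 D)); first exact: Rintegral_cst.
  exact: (congr1 (fun y => C * fine y) muD).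
rewrite -muC; apply: (@le_Rintegral _ _ _ mu2 D (fun z => `|g z|) (cst C) mD).
- exact: integrable_norm.
- apply: (@measurable_bounded_integrable _ _ _ mu2 (cst C) D mD).
    by rewrite [X in (X < _)%E]muD ltry.
    exact: measurable_cst.
  by exists `|C|; split; [rewrite num_real|move=> N CN z _; exact: ltW].
- by move=> z _; exact: gC.
Qed.

End LocallyBounded.

(** * Consistency for test functions *)

Section Derivatives.
Context {R : realType}.
Implicit Types (g : R * R -> R).

(** Compactness, in its near-covering form, gives a uniform [d] on the ball of radius [X + 1].
    Beyond that ball, [d < 1] keeps both points outside the support. *)
Lemma unif_continuous_boxed g X (e : R) : continuous g ->
  (forall z, X < `|z| -> g z = 0) -> 0 < e ->
  exists2 d : R, 0 < d & forall z z', `|z - z'| <= d -> `|g z - g z'| <= e.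
Proof.
move=> cg g0 e0.
have := (compact_near_coveringP _).1 (@compact_ball_plane R (X + 1)).
move=> /(_ R (0^'+) (fun d z => forall z', `|z - z'| <= d -> `|g z - g z'| <= e)).
have loc z : [set z | `|z| <= X + 1] z -> \forall x' \near z & d \near (0 : R)^'+,
    forall z', `|x' - z'| <= d -> `|g x' - g z'| <= e.
  move=> _; have e2 : 0 < e / 2 by rewrite divr_gt0.
  have /cvgrPdist_le/(_ _ e2)/nbhs_ballP[r /= r0 gr] := cg z.
  have r2 : 0 < r / 2 by rewrite divr_gt0.
  near=> x' d => z' xz.
  have xr : `|z - x'| < r / 2 by near: x'; exact: (@cvgr_dist_lt _ _ _ _ _ id).
  have dr : d < r / 2 by near: d; exact: nbhs_right_lt.
  have -> : g x' - g z' = (g z - g z') - (g z - g x') by ring.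
  have Bx : ball z r x' by rewrite -ball_normE/=; apply: (lt_trans xr); lra.
  have Bz : ball z r z'.
    rewrite -ball_normE/=.
    have -> : z - z' = (z - x') + (x' - z') by rewrite addrA subrK.
    rewrite (le_lt_trans (ler_normD _ _))// (splitr r) ltr_leD//.
    exact: le_trans xz (ltW dr).
  have := gr _ Bx; have := gr _ Bz; have := ler_normB (g z - g z') (g z - g x').
  lra.
move=> /(_ _ loc) near0.
have : \forall d \near (0 : R)^'+, d < 1 /\ 0 < d /\
    forall z, `|z| <= X + 1 -> forall z', `|z - z'| <= d -> `|g z - g z'| <= e.
  near=> d; split; first by near: d; exact: nbhs_right_lt.
  split; first by near: d; exact: nbhs_right_gt.
  by near: d.
move=> /filter_ex[d [d1 [d0 H]]]; exists d => // z z' zz'.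
have [zX|zX] := leP `|z| (X + 1); first exact: H.
rewrite !g0 ?subrr ?normr0 ?ltW//; last lra.
have := lerB_dist z z'; lra.
Unshelve. all: by end_near. Qed.

(** Passing to one real variable makes the mean value theorem available for partial derivatives. *)
Lemma is_derive_ddx g x t : derivable g (x, t) ((1, 0) : R * R) ->
  is_derive x 1 (fun r => g (r, t)) (ddx g (x, t)).
Proof.
move=> dg.
have E : (fun h : R => h^-1 *: (((fun r => g (r, t)) \o shift x) (h *: 1) - g (x, t)))
    = (fun h : R => h^-1 *: ((g \o shift (x, t)) (h *: ((1, 0) : R * R)) - g (x, t))).
  apply/funext => h /=; congr (_ *: (g _ - _)).
  by congr pair; rewrite /= scaler0 add0r.
split; first by rewrite /derivable E.
by rewrite /derive E.
Qed.

Lemma is_derive_ddt g x t : derivable g (x, t) ((0, 1) : R * R) ->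
  is_derive t 1 (fun r => g (x, r)) (ddt g (x, t)).
Proof.
move=> dg.
have E : (fun h : R => h^-1 *: (((fun r => g (x, r)) \o shift t) (h *: 1) - g (x, t)))
    = (fun h : R => h^-1 *: ((g \o shift (x, t)) (h *: ((0, 1) : R * R)) - g (x, t))).
  apply/funext => h /=; congr (_ *: (g _ - _)).
  by congr pair; rewrite /= scaler0 add0r.
split; first by rewrite /derivable E.
by rewrite /derive E.
Qed.

Lemma derive_eq0_outside g X v : (forall z, X < `|z| -> g z = 0) ->
  forall z, X < `|z| -> 'D_v g z = 0.
Proof.
move=> g0 z zX; rewrite (@near_eq_derive _ _ _ g (cst 0)) ?derive_cst//.
near=> y; apply: g0; near: y.
have e0 : 0 < `|z| - X by rewrite subr_gt0.
near=> y; have : `|z - y| < `|z| - X by near: y; exact: (@cvgr_dist_lt _ _ _ _ _ id).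
have := lerB_dist z y; lra.
Unshelve. all: by end_near. Qed.

Lemma MVT_derive (F dF : R -> R) (a b : R) : a < b ->
  (forall x : R, is_derive x 1 F (dF x)) ->
  exists2 c, a < c < b & F b - F a = dF c * (b - a).
Proof.
move=> ab dFx.
have cF : {within `[a, b], continuous F}.
  by apply: derivable_within_continuous => x _; have [] := dFx x.
have [c] := MVT ab (fun x _ => dFx x) cF.
by rewrite in_itv/= => cab E; exists c.
Qed.

(** The mean value theorem is used twice: on [F r = g (r + h, t) - g (r, t)] over [[x - h, x]], and
    then on [ddx g]. The result has no remainder and asks for no third derivative. *)
Lemma second_difference g (x t h : R) : 0 < h ->
  (forall z, derivable g z ((1, 0) : R * R)) ->
  (forall z, derivable (ddx g) z ((1, 0) : R * R)) ->
  exists2 y, `|y - x| <= h &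
    g (x + h, t) - 2 * g (x, t) + g (x - h, t) = h ^+ 2 * ddx (ddx g) (y, t).
Proof.
move=> h0 dg ddg.
pose F (r : R) := g (r + h, t) - g (r, t).
pose dF (r : R) := ddx g (r + h, t) - ddx g (r, t).
have dFx (r : R) : is_derive r 1 F (dF r).
  apply: is_deriveB; last exact: is_derive_ddx.
  have := is_derive_ddx g (r + h) t (dg _) => dgh.
  have dsh : is_derive r 1 (fun s : R => s + h) (1 + 0) by apply: is_deriveD.
  have := @is_derive1_comp R (fun s => g (s, t)) (fun s : R => s + h) r _ _ dgh dsh.
  by rewrite addr0 mulr1.
have [|y /andP[y1 y2] Fy] := MVT_derive F dF (x - h) x _ dFx; first lra.
have [|w /andP[w1 w2] Gw] := MVT_derive (fun r => ddx g (r, t))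
  (fun r => ddx (ddx g) (r, t)) y (y + h) _
  (fun r => is_derive_ddx (ddx g) r t (ddg _)); first lra.
exists w; first by rewrite ler_norml; apply/andP; split; lra.
have -> : g (x + h, t) - 2 * g (x, t) + g (x - h, t) = F x - F (x - h).
  by rewrite /F subrK; ring.
by rewrite Fy /dF Gw; ring.
Qed.

(** The left side is split at [g (x, t + k)] into a time increment and a second difference taken at
    time [t + k]. For [k = h ^ 2 / 2] the right side is [k] times the adjoint heat operator, with
    its two terms evaluated at nearby points. *)
Lemma parabolic_taylor g (x t h k : R) : 0 < h -> 0 < k ->
  (forall z, derivable g z ((1, 0) : R * R)) ->
  (forall z, derivable g z ((0, 1) : R * R)) ->
  (forall z, derivable (ddx g) z ((1, 0) : R * R)) ->
  exists z1 z2, [/\ `|z1 - (x, t)| <= h + k, `|z2 - (x, t)| <= h + k &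
    g (x, t) - (g (x + h, t + k) + g (x - h, t + k)) / 2
    = - (k * ddt g z1) - h ^+ 2 / 2 * ddx (ddx g) z2].
Proof.
move=> h0 k0 dgx dgt ddg.
have [y yx E] := second_difference g x (t + k) h h0 dgx ddg.
have [|s /andP[s1 s2] Es] := MVT_derive (fun r => g (x, r)) (fun r => ddt g (x, r))
  t (t + k) _ (fun r => is_derive_ddt g x r (dgt _)); first lra.
exists (x, s), (y, t + k); split; rewrite ?pair_dist_le/=.
- apply/andP; split; first by rewrite subrr normr0; lra.
  by rewrite ler_norml; apply/andP; split; lra.
- apply/andP; split; first by apply: (le_trans yx); lra.
  by rewrite addrAC subrr add0r gtr0_norm//; lra.
- have : g (x, t + k) - g (x, t) = k * ddt g (x, s) by rewrite Es; ring.
  lra.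
Qed.

End Derivatives.

(** * The limit of the scheme *)

Lemma ultra_fmap (T S : Type) (F : set_system T) (g : T -> S) :
  UltraFilter F -> UltraFilter (g x @[x --> F]).
Proof.
move=> UF; have PF := @ultra_proper _ _ UF.
split; first exact: fmap_proper_filter.
move=> G PG FG; apply/seteqP; split => // A GA.
(* Maximality: otherwise the complement of [A] would belong to the image filter, hence to [G]
   together with [A]. *)
have [//|FnA] := in_ultra_setVsetC (g @^-1` A) UF.
have GnA : G (~` A) by apply: FG.
by by have [s []] := @filter_ex _ _ PG _ (filterI GA GnA).
Qed.

Section SchemeLimit.
Context (R : realType) (f u0 : R -> R) (K1 M L : R).
Hypotheses (hK1 : 0 < K1) (hf : forall u v, `|f u - f v| <= K1 * `|u - v|).
Hypotheses (hM : forall x, `|u0 x| <= M).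
Hypotheses (hL : forall x y, `|u0 x - u0 y| <= L * `|x - y|).

Lemma lipschitz_continuous (F : R -> R) (K : R) :
  (forall x y, `|F x - F y| <= K * `|x - y|) -> continuous F.
Proof.
move=> FK x; apply/cvgrPdist_le => e e0.
have K0 : 0 < `|K| + 1 by rewrite ltr_wpDl.
near=> y; apply: (le_trans (FK _ _)).
have : `|x - y| < e / (`|K| + 1).
  by near: y; apply: (@cvgr_dist_lt _ _ _ _ _ id) => //; rewrite divr_gt0.
rewrite ltr_pdivlMr// => /ltW; apply: le_trans.
rewrite mulrC ler_wpM2l//; have := ler_norm K; lra.
Unshelve. all: by end_near. Qed.

(** For [0 <= t], adding [k] raises the truncated quotient by exactly one. For negative [t] the
    truncation to 0 breaks this, and there the initial datum enters the weak identity. *)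
Lemma approx_step (h x t : R) : 0 < h -> 0 <= t ->
  approx f u0 h (x, t + h ^+ 2 / 2) =
  (approx f u0 h (x + h, t) + approx f u0 h (x - h, t)) / 2
  + h ^+ 2 / 2 * f (approx f u0 h (x, t)).
Proof.
move=> h0 t0; have k0 : 0 < h ^+ 2 / 2 by rewrite divr_gt0 ?exprn_gt0.
rewrite /approx/=; set k := h ^+ 2 / 2 in k0 *.
have -> : Num.truncn ((t + k) / k) = (Num.truncn (t / k)).+1.
  have /truncn_itv/andP[n1 n2] : 0 <= t / k by rewrite divr_ge0// ltW.
  apply: truncn_def; rewrite mulrDl divff ?gt_eqF//.
  by apply/andP; split; move: n1 n2; rewrite -!natr1; lra.
by [].
Qed.

Lemma approx_initial (h x t : R) : 0 < h -> t < h ^+ 2 / 2 ->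
  approx f u0 h (x, t) = u0 x.
Proof.
move=> h0 tk; have k0 : 0 < h ^+ 2 / 2 by rewrite divr_gt0 ?exprn_gt0.
rewrite /approx/= (_ : Num.truncn _ = 0%N)//.
by apply/truncn0Pn; rewrite -ltNge ltr_pdivrMr// mul1r.
Qed.

Lemma approx_loc_bounded (h : R) : 0 < h -> loc_bounded (approx f u0 h).
Proof.
move=> h0; have k0 : 0 < h ^+ 2 / 2 by rewrite divr_gt0 ?exprn_gt0.
split; last first.
  move=> X; exists (sup_bound f K1 M `|X|) => -[x t].
  rewrite pair_norm_le/= => /andP[_ tX].
  have tX' : (x, t).2 <= `|X|.
    by rewrite /= (le_trans (ler_norm t))// (le_trans tX)// ler_norm.
  have := approx_bounded _ _ _ _ _ hK1 hf hM h `|X| (x, t) h0 (normr_ge0 _) tX'.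
  by apply: le_trans; rewrite lerDr divr_ge0// ltW.
move=> _ Y mY; rewrite setTI.
(* On each time level [approx h] is a continuous function of [x] alone, so a preimage is a countable
   union of measurable rectangles. *)
have -> : approx f u0 h @^-1` Y = \bigcup_m
    ((scheme f u0 h (h ^+ 2 / 2) m @^-1` Y)
     `*` [set t | Num.truncn (t / (h ^+ 2 / 2)) = m]).
  apply/seteqP; split=> [[x t] xt|[x t] [m _ [/= xY tm]]]; last first.
    by rewrite /approx/= tm.
  by exists (Num.truncn (t / (h ^+ 2 / 2))).
apply: bigcupT_measurable => m; apply: measurableX.
  rewrite -[X in measurable X]setTI; apply: continuous_measurable_fun => //.
  apply: lipschitz_continuous => x y.
  exact: (scheme_lipschitz _ _ _ _ _ hK1 hf hL h _ m x y (ltW k0)).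
apply: is_interval_measurable => a b /= am bm z /andP[az zb].
have lz : (Num.truncn (a / (h ^+ 2 / 2)) <= Num.truncn (z / (h ^+ 2 / 2)))%N.
  by apply: le_truncn; rewrite ler_pM2r ?invr_gt0.
have zl : (Num.truncn (z / (h ^+ 2 / 2)) <= Num.truncn (b / (h ^+ 2 / 2)))%N.
  by apply: le_truncn; rewrite ler_pM2r ?invr_gt0.
by apply/eqP; rewrite eqn_leq; move: lz zl; rewrite am bm => -> ->.
Qed.

(* An ultrafilter makes all the bounded sequences [approx (1/(n+1)) z] converge
   at once, with no diagonal extraction of a subsequence. *)
Lemma scheme_limit : exists2 u : R * R -> R, continuous u &
  forall X e : R, 0 < e -> exists h : R, [/\ 0 < h, h <= e &
    forall z, `|z| <= X -> `|approx f u0 h z - u z| <= e].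
Proof.
(* [U] refines the filter of eventual properties, so the step sizes still tend to 0 along it. *)
have [U [UU sU]] := ultraFilterLemma (@eventually_filter).
have PU := @ultra_proper _ _ UU.
pose v n := approx f u0 (@harmonic R n).
have hn0 n : 0 < @harmonic R n by exact: harmonic_gt0.
have lim_ex z : exists l : R, v n z @[n --> U] --> l.
  have seg n : `[- sup_bound f K1 M `|z|, sup_bound f K1 M `|z|]%classic (v n z).
    rewrite /= in_itv/= -ler_norml.
    have zz : z.2 <= `|z|.
      apply: (le_trans (ler_norm _)).
      by have := lexx `|z|; rewrite {1}pair_norm_le => /andP[].
    have := approx_bounded _ _ _ _ _ hK1 hf hM _ `|z| z (hn0 n) (normr_ge0 _) zz.
    by apply: le_trans; rewrite lerDr divr_ge0// ltW.
  have := @segment_compact R (- sup_bound f K1 M `|z|) (sup_bound f K1 M `|z|).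
  rewrite compact_ultra => /(_ _ (ultra_fmap _ _ U (fun n => v n z) UU)) [].
    exact: (@filterE _ U).
  by move=> l [_ zl]; exists l.
have [u vu] := choice lim_ex.
have small (r : R) : 0 < r -> \forall n \near U, @harmonic R n <= r.
  move=> r0; apply: sU; have := @cvg_harmonic R => /cvgrPdist_le/(_ _ r0).
  by apply: filterS => n; rewrite sub0r normrN ger0_norm// ltW.
have smallk (r : R) : 0 < r -> \forall n \near U, @harmonic R n ^+ 2 / 2 <= r.
  move=> r0; have [H1 H2] := (small r r0, small 1 ltr01); near=> n.
  have h1 : @harmonic R n <= 1 by near: n.
  have hr : @harmonic R n <= r by near: n.
  by have := hn0 n; nra.
have equi z0 (e : R) : 0 < e -> \forall z \near z0 & n \near U,
    `|v n z - v n z0| <= e.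
  move=> e0; have [r r0 H] := approx_equicontinuous _ _ _ _ _ _ hK1 hf hM hL z0 e e0.
  exists ([set z | `|z0 - z| < r], [set n | @harmonic R n ^+ 2 / 2 <= r]).
    split=> /=; last exact: smallk.
    by apply/nbhs_ballP; exists r => //= z; rewrite -ball_normE.
  by move=> [z n] [/= zr nr]; apply: H => //; rewrite distrC ltW.
have uequi z0 (e : R) : 0 < e -> \forall z \near z0, `|u z - u z0| <= e.
  move=> e0; have e3 : 0 < e / 3 by rewrite divr_gt0.
  have [[A B] /= [zA UB] AB] := equi z0 _ e3.
  near=> z; have Az : A z by near: z.
  near U => n.
  have Bn : B n by near: n.
  have n1 : `|u z - v n z| <= e / 3 by near: n; have /cvgrPdist_le := vu z; apply.
  have n2 : `|u z0 - v n z0| <= e / 3 by near: n; have /cvgrPdist_le := vu z0; apply.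
  have n3 : `|v n z - v n z0| <= e / 3 by exact: (AB (z, n)).
  have -> : u z - u z0 = (u z - v n z) + (v n z - v n z0) - (u z0 - v n z0) by ring.
  have := ler_normB ((u z - v n z) + (v n z - v n z0)) (u z0 - v n z0).
  have := ler_normD (u z - v n z) (v n z - v n z0).
  lra.
exists u.
  move=> z0; apply/cvgrPdist_le => e e0; have := uequi z0 e e0.
  by apply: filterS => z; rewrite distrC.
move=> X e e0.
(* Pointwise convergence and equicontinuity give closeness near each point, and compactness of the
   ball makes it uniform for a single set of indices in [U]. *)
have := (compact_near_coveringP _).1 (@compact_ball_plane R X).
move=> /(_ nat U (fun n z => `|v n z - u z| <= e)).
have loc z : [set z | `|z| <= X] z -> \forall z' \near z & n \near U,
    `|v n z' - u z'| <= e.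
  move=> _; have e3 : 0 < e / 3 by rewrite divr_gt0.
  have [[A B] /= [zA UB] AB] := equi z _ e3; have E' := uequi z _ e3.
  near=> z' n.
  have Az' : A z' by near: z'.
  have Bn : B n by near: n.
  have n1 : `|v n z' - v n z| <= e / 3 by exact: (AB (z', n)).
  have n2 : `|u z - v n z| <= e / 3 by near: n; have /cvgrPdist_le := vu z; apply.
  have n3 : `|u z' - u z| <= e / 3 by near: z'.
  have -> : v n z' - u z' = (v n z' - v n z) - (u z - v n z) - (u z' - u z) by ring.
  have := ler_normB ((v n z' - v n z) - (u z - v n z)) (u z' - u z).
  have := ler_normB (v n z' - v n z) (u z - v n z).
  lra.
move=> /(_ _ loc) unif; near U => n.
exists (@harmonic R n); split => //; first by near: n; exact: small.
by near: n.
Unshelve. all: by end_near. Qed.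
End SchemeLimit.

(** * The weak identity *)

Section WeakIdentity.
Context {R : realType}.
Local Notation mu := (@lebesgue_measure R).
Local Notation mu2 := (mu \x mu)%E.

(** As a real factor, the indicator of the half plane turns every integral into one over the whole
    plane, where translations act. *)
Definition upper (z : R * R) : R := (0 <= z.2)%R%:R.

Lemma upper_indic : upper = \1_(half_plane : set (R * R)).
Proof.
apply/funext => z; rewrite indicE /upper; congr ((nat_of_bool _)%:R).
by apply/idP/idP; rewrite inE.
Qed.

Lemma measurable_half_plane : measurable (half_plane : set (R * R)).
Proof.
rewrite (_ : half_plane = setT `*` `[0, +oo[%classic).
  by apply: measurableX => //; exact: measurable_itv.
by apply/seteqP; split=> [[x t]|[x t] []] /=; rewrite /half_plane/= in_itv/= andbT.
Qed.

Lemma loc_bounded_upper : loc_bounded upper.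
Proof.
split; last by move=> X; exists 1 => z _; rewrite /upper ger0_norm ?ler0n// lern1 leq_b1.
by rewrite upper_indic; apply: measurable_indic; exact: measurable_half_plane.
Qed.

Lemma integral_half_plane (g : R * R -> R) :
  (\int[mu2]_(z in half_plane) (g z)%:E = \int[mu2]_z (upper z * g z)%:E)%E.
Proof.
rewrite integral_mkcond; apply: eq_integral => z _.
rewrite patchE /upper; case: ifPn; rewrite /half_plane.
  by rewrite inE/= => ->; rewrite mul1r.
by rewrite notin_setE/= => /negP/negbTE ->; rewrite mul0r.
Qed.

(** What is left when [upper] is shifted by one time step: the indicator of a layer of height [k]
    just below time 0. *)
Definition strip (k : R) (z : R * R) : R := upper (translate (0, k) z) - upper z.

Lemma stripE (k : R) z : 0 <= k -> strip k z = (- k <= z.2 < 0)%R%:R.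
Proof.
move=> k0; rewrite /strip /upper /translate/=.
have [z0|z0] := leP 0 z.2; last by rewrite subr0 andbT -lerBlDr sub0r.
by rewrite andbF addr_ge0// subrr.
Qed.

Lemma loc_bounded_strip (k : R) : loc_bounded (strip k).
Proof.
apply: loc_boundedB; last exact: loc_bounded_upper.
by apply: loc_bounded_translate; exact: loc_bounded_upper.
Qed.

Lemma continuous_fst_comp (a : R -> R) : continuous a ->
  continuous (fun z : R * R => a z.1).
Proof.
move=> ca [x t]; apply: (@cvg_comp _ _ _ fst a _ (nbhs x)); last exact: ca.
exact: cvg_fst.
Qed.

Lemma boxed_strip (k X : R) (a : R -> R) : 0 <= k -> continuous a ->
  (forall x, X < `|x| -> a x = 0) -> boxed (fun z => strip k z * a z.1).
Proof.
move=> k0 ca a0; split.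
  apply: loc_boundedM; first exact: loc_bounded_strip.
  by apply: loc_bounded_continuous; exact: continuous_fst_comp.
exists (Num.max X k) => -[x t]; rewrite stripE//=.
rewrite prod_normE/= lt_max !gt_max => /orP[/andP[xX _]|/andP[_ tk]].
  by rewrite a0// mulr0.
case: (boolP (- k <= t < 0)) => [/andP[t1 t2]|_]; last by rewrite mul0r.
by move: tk; rewrite ltr0_norm//; lra.
Qed.

Lemma integrable_compact_support (X : R) (a : R -> R) : continuous a ->
  (forall x, X < `|x| -> a x = 0) -> mu.-integrable setT (EFin \o a).
Proof.
move=> ca a0; have mD : measurable `[- X, X]%classic := measurable_itv _.
have -> : EFin \o a = (EFin \o a) \_ `[- X, X]%classic.
  apply/funext => x; rewrite patchE; case: ifPn => // /negP xD /=.
  rewrite a0// ltNge; apply/negP => xX; apply: xD.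
  by rewrite inE/= in_itv/= -ler_norml.
apply: (@integrable_mkcond _ _ _ mu _ (EFin \o a) mD).1.
apply: continuous_compact_integrable; first exact: segment_compact.
exact: continuous_subspaceT.
Qed.

(** Fubini, with each vertical section of the strip of length [k]. It writes the initial integral as
    a plane integral, comparable with the other terms. *)
Lemma integral_strip (k X : R) (a : R -> R) : 0 <= k -> continuous a ->
  (forall x, X < `|x| -> a x = 0) ->
  \int[mu2]_z (strip k z * a z.1) = k * \int[mu]_x a x.
Proof.
move=> k0 ca a0.
have ia := integrable_compact_support _ _ ca a0.
have ib := boxed_integrable _ (boxed_strip _ _ _ k0 ca a0).
rewrite -[RHS](@RintegralZl _ _ _ mu setT a k measurableT ia).
congr fine; apply: (etrans (esym (@integral12_prod_meas1 _ _ _ _ _ mu mu _ ib))).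
apply: eq_integral => x _; rewrite /fubini_F/=.
transitivity (\int[mu]_y ((a x)%:E * (\1_`[(- k), 0[%classic y)%:E))%E.
  apply: eq_integral => y _; rewrite stripE//= -EFinM mulrC; congr ((_ * _)%:E).
  rewrite indicE; congr ((nat_of_bool _)%:R).
  by apply/idP/idP; rewrite inE/= in_itv.
rewrite (@integralZl _ _ _ mu setT measurableT _ (integrable_indic_itv _ _ _ _)).
rewrite EFinM muleC; congr (_ * _)%E.
have mI : measurable `[(- k), 0[%classic := measurable_itv _.
apply: (etrans (@integral_indic _ _ _ mu setT measurableT _ mI)).
rewrite setIT; apply: (etrans (lebesgue_measure_itv _)).
rewrite /= lte_fin -EFinB; case: ifPn => k1; congr EFin; lra.
Qed.

End WeakIdentity.

(** * The exact weak identity satisfied by the scheme *)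

Section DiscreteWeakIdentity.
Context {R : realType}.
Local Notation mu := (@lebesgue_measure R).
Local Notation mu2 := (mu \x mu)%E.

Lemma integral_boxedD (g1 g2 : R * R -> R) : boxed g1 -> boxed g2 ->
  \int[mu2]_z (g1 z + g2 z) = \int[mu2]_z g1 z + \int[mu2]_z g2 z.
Proof.
move=> b1 b2; apply: (@RintegralD _ _ _ mu2 setT g1 g2 measurableT);
  exact: boxed_integrable.
Qed.

Lemma integral_boxedB (g1 g2 : R * R -> R) : boxed g1 -> boxed g2 ->
  \int[mu2]_z (g1 z - g2 z) = \int[mu2]_z g1 z - \int[mu2]_z g2 z.
Proof.
move=> b1 b2; apply: (@RintegralB _ _ _ mu2 setT g1 g2 measurableT);
  exact: boxed_integrable.
Qed.

Lemma integral_boxedZ (c : R) (g : R * R -> R) : boxed g ->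
  \int[mu2]_z (c * g z) = c * \int[mu2]_z g z.
Proof.
move=> b; apply: (@RintegralZl _ _ _ mu2 setT g c measurableT).
exact: boxed_integrable.
Qed.

Context (f u0 : R -> R) (K1 M L : R).
Hypotheses (hK1 : 0 < K1) (hf : forall u v, `|f u - f v| <= K1 * `|u - v|).
Hypotheses (hM : forall x, `|u0 x| <= M).
Hypotheses (hL : forall x y, `|u0 x - u0 y| <= L * `|x - y|).
Context (h : R) (phi : R * R -> R).
Hypotheses (h0 : 0 < h) (bphi : boxed phi).

Local Notation k := (h ^+ 2 / 2).
Local Notation v := (approx f u0 h).

(** The discrete counterpart of [k] times the weak integrand, with the adjoint of one step acting on
    [phi]. The shifts by [k] appear because the recursion produces the value at the next time
    level. *)
Definition adjoint_step (z : R * R) : R :=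
  upper z * (v z * (phi z
    - (phi (translate (h, k) z) + phi (translate (- h, k) z)) / 2)
    - k * f (v z) * phi (translate (0, k) z)).

Let k0 : 0 < k. Proof. by rewrite divr_gt0 ?exprn_gt0. Qed.
Let cf : continuous f. Proof. exact: lipschitz_continuous hf. Qed.
Let bv : loc_bounded v. Proof. exact: approx_loc_bounded hK1 hf hM hL h h0. Qed.

Lemma boxed_adjoint_step : boxed adjoint_step.
Proof.
apply: boxedM; first exact: loc_bounded_upper.
apply: boxedB.
  apply: boxedM => //; apply: boxedB => //.
  under eq_fun do rewrite mulrC.
  by apply: boxedZ; apply: boxedD; exact: boxed_translate.
apply: boxedM; last exact: boxed_translate.
apply: loc_boundedM; first exact: loc_bounded_cst.
exact: loc_bounded_comp.
Qed.

Let initial z := strip k z * u0 z.1 * phi (translate (0, k) z).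

Lemma boxed_initial : boxed initial.
Proof.
apply: boxedM; last exact: boxed_translate.
apply: loc_boundedM; first exact: loc_bounded_strip.
apply: loc_bounded_continuous; apply: continuous_fst_comp.
exact: lipschitz_continuous hL.
Qed.

(* Summation by parts: by the recursion of the scheme, the difference of the two
   integrands is a sum of functions of the form [g z - g (z + c)]. *)
Lemma discrete_weak_identity :
  \int[mu2]_z adjoint_step z
  = \int[mu2]_z (strip k z * u0 z.1 * phi (translate (0, k) z)).
Proof.
(* [P] carries the time increment. In [Q c], translation by [(- c, 0)] moves the spatial shift from
   the scheme to the test function. *)
pose P z := upper z * v z * phi z.
pose Q c z := upper z * v (translate (c, 0) z) * phi (translate (0, k) z).
have bP : boxed P.
  by apply: boxedM => //; apply: loc_boundedM => //; exact: loc_bounded_upper.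
have bQ c : boxed (Q c).
  apply: boxedM; last exact: boxed_translate.
  apply: loc_boundedM; first exact: loc_bounded_upper.
  exact: loc_bounded_translate.
pose dP z := P z - P (translate (0, k) z).
pose dQ c z := 2^-1 * (Q c z - Q c (translate (- c, 0) z)).
have bdP : boxed dP by apply: boxedB => //; exact: boxed_translate.
have bdQ c : boxed (dQ c).
  by apply: boxedZ; apply: boxedB => //; exact: boxed_translate.
have dQ0 c : \int[mu2]_z dQ c z = 0.
  rewrite integral_boxedZ; first by rewrite integral_sub_translate// mulr0.
  by apply: boxedB => //; exact: boxed_translate.
apply/eqP; rewrite -subr_eq0 -(integral_boxedB _ _ boxed_adjoint_step boxed_initial).
have -> : (fun z => adjoint_step z - initial z)
    = (fun z => dP z + (dQ h z + dQ (- h) z)).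
  apply/funext => -[x t].
  rewrite /adjoint_step /initial /dP /dQ /P /Q stripE ?(ltW k0)//.
  rewrite /upper /translate/= !addr0 !opprK subrK addrK.
  (* For [0 <= t] this is the recursion. For [t < 0] only the shifted half of [dP] can survive; it
     does so on the strip, where the time [t + k] is below [k] and the scheme still equals [u0]. *)
  have [t0|t0] := leP 0 t.
    rewrite andbF (addr_ge0 t0 (ltW k0)) (approx_step _ f u0 h x t h0 t0).
    by rewrite mulr1n mulr0n; field.
  rewrite andbT !mul0r subrr mulr0 !addr0 sub0r.
  have -> : (0 <= t + k) = (- k <= t) by rewrite -lerBlDr sub0r.
  have [tk|tk] := leP (- k) t; last by rewrite mulr0n !mul0r sub0r.
  by rewrite approx_initial //; [rewrite sub0r|lra].
rewrite (integral_boxedD dP (fun z => dQ h z + dQ (- h) z))//; last exact: boxedD.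
rewrite (integral_boxedD (dQ h) (dQ (- h)))// !dQ0 !addr0.
exact/eqP/integral_sub_translate.
Qed.

End DiscreteWeakIdentity.

(** * Error estimate for the weak identity and passage to the limit *)

Section PassageToTheLimit.
Context {R : realType}.
Local Notation mu := (@lebesgue_measure R).
Local Notation mu2 := (mu \x mu)%E.

Lemma boxed_continuous (g : R * R -> R) X : continuous g ->
  (forall z, X < `|z| -> g z = 0) -> boxed g.
Proof. by move=> cg g0; split; [exact: loc_bounded_continuous|exists X]. Qed.

Lemma boxed_bounded (g : R * R -> R) : boxed g ->
  exists2 C : R, 0 <= C & forall z, `|g z| <= C.
Proof.
move=> [[_ bg] [X g0]]; have [C gC] := bg X; exists `|C| => // z.
have [zX|zX] := leP `|z| X; first by rewrite (le_trans (gC _ zX))// ler_norm.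
by rewrite g0// normr0.
Qed.

Lemma translate_outside (g : R * R -> R) X c z : (forall z, X < `|z| -> g z = 0) ->
  X + `|c| < `|z| -> g (translate c z) = 0.
Proof.
move=> g0 Xz; apply: g0; rewrite -[translate c z]/(z + c).
by have := lerB_normD z c; move: Xz; rewrite -ltrBrDr => /lt_le_trans; apply.
Qed.

Context (f u0 : R -> R) (K1 M L : R).
Hypotheses (hK1 : 0 < K1) (hf : forall u v, `|f u - f v| <= K1 * `|u - v|).
Hypotheses (hM : forall x, `|u0 x| <= M).
Hypotheses (hL : forall x y, `|u0 x - u0 y| <= L * `|x - y|).
Context (u phi : R * R -> R) (X : R).
Hypotheses (cu : continuous u) (X0 : 0 <= X).
Hypotheses (cphi : continuous phi) (ct : continuous (ddt phi))
  (cxx : continuous (ddx (ddx phi))).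
Hypotheses (dx : forall z, derivable phi z ((1, 0) : R * R))
  (dt : forall z, derivable phi z ((0, 1) : R * R))
  (dxx : forall z, derivable (ddx phi) z ((1, 0) : R * R)).
Hypothesis (phi0 : forall z, X < `|z| -> phi z = 0).

Let weak_integrand z :=
  u z * (- ddx (ddx phi) z - ddt phi z) - f (u z) * phi z.

Let bphi : boxed phi. Proof. exact: boxed_continuous cphi phi0. Qed.

Let phit0 z : X < `|z| -> ddt phi z = 0.
Proof. exact: derive_eq0_outside. Qed.

Let phixx0 z : X < `|z| -> ddx (ddx phi) z = 0.
Proof. by apply: derive_eq0_outside => z'; exact: derive_eq0_outside. Qed.

Let cf : continuous f. Proof. exact: lipschitz_continuous hf. Qed.

Lemma boxed_weak_integrand : boxed weak_integrand.
Proof.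
apply: boxedB.
  apply: boxedM; first exact: loc_bounded_continuous.
  apply: boxedB; last exact: boxed_continuous ct phit0.
  have := boxedZ (-1) _ (boxed_continuous _ _ cxx phixx0).
  by under eq_fun do rewrite mulN1r.
apply: boxedM => //; apply: loc_bounded_comp => //.
exact: loc_bounded_continuous.
Qed.

Context (h : R).
Hypotheses (h0 : 0 < h) (h1 : 2 * h <= 1 :> R).
Local Notation k := (h ^+ 2 / 2).
Local Notation v := (approx f u0 h).
Local Notation B := (sup_bound f K1 M (X + 1)).

Let k0 : 0 < k. Proof. by rewrite divr_gt0 ?exprn_gt0. Qed.
Let kh : k <= h.
Proof.
have : h * (2 * h) <= h * 1 by rewrite ler_pM2l.
by have := h0; rewrite expr2; lra.
Qed.

(** The consistency error of one step, combining the replacement of [v] by [u] with that of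
    difference quotients by derivatives. *)
Let residual z := k * (upper z * weak_integrand z) - adjoint_step f u0 h phi z.

Let residual_outside z : X + 1 < `|z| -> residual z = 0.
Proof.
move=> zX; have zX' : X < `|z| by apply: lt_trans zX; rewrite ltrDl.
have small c1 : `|c1| <= h -> X + `|((c1, k) : R * R)| < `|z|.
  move=> c1h; apply: le_lt_trans zX; rewrite lerD2l.
  have hle1 : h <= 1 :> R by have := h0; have := h1; lra.
  rewrite pair_norm_le/= (gtr0_norm k0) (le_trans c1h hle1).
  exact: le_trans kh hle1.
rewrite /residual /weak_integrand /adjoint_step phi0// phit0// phixx0//.
rewrite !(translate_outside _ _ _ _ phi0) ?small ?normrN ?normr0 ?(ltW h0)//.
- by ring.
- by rewrite gtr0_norm.
- by rewrite gtr0_norm.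
Qed.

Context (C e d : R).
Hypotheses (e0 : 0 < e) (hd : 2 * h <= d :> R).
Hypotheses (phiC : forall z, `|phi z| <= C) (phitC : forall z, `|ddt phi z| <= C)
  (phixxC : forall z, `|ddx (ddx phi) z| <= C).
Hypotheses (phiU : forall z z', `|z - z'| <= d -> `|phi z - phi z'| <= e)
  (phitU : forall z z', `|z - z'| <= d -> `|ddt phi z - ddt phi z'| <= e)
  (phixxU : forall z z', `|z - z'| <= d ->
     `|ddx (ddx phi) z - ddx (ddx phi) z'| <= e).
Hypothesis (close : forall z, `|z| <= X + 1 -> `|v z - u z| <= e).

Let residual_bound z :
  `|residual z| <= k * (e * (2 * C + 2 * B + K1 * C + K1 * B)).
Proof.
have [h0' kh' hd' X0' k0'] : [/\ 0 < h, k <= h, 2 * h <= d, 0 <= X & 0 < k] by [].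
have a0 : 0 <= `|f 0| / K1 by rewrite divr_ge0// ltW.
have C0 : 0 <= C := le_trans (normr_ge0 _) (phiC z).
have XT : 0 <= X + 1 by rewrite addr_ge0.
have B0 : 0 <= B.
  rewrite mulr_ge0 ?expR_ge0// addr_ge0// (le_trans _ (hM 0))//.
have N0 : 0 <= 2 * C + 2 * B + K1 * C + K1 * B.
  by rewrite !addr_ge0// mulr_ge0// ltW.
have R0 : 0 <= k * (e * (2 * C + 2 * B + K1 * C + K1 * B)).
  by rewrite mulr_ge0 ?(ltW k0)// mulr_ge0// ltW.
have [zX|zX] := leP `|z| (X + 1); last by rewrite residual_outside// normr0.
case: z zX => x t zX; rewrite /residual /weak_integrand /adjoint_step /upper/=.
have [t0|t0] := leP 0 t; last by rewrite mulr0n !mul0r mulr0 subrr normr0.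
have tX : (x, t).2 <= X + 1.
  by move: zX; rewrite pair_norm_le/= => /andP[_ /(le_trans (ler_norm _))].
have vB := approx_bounded _ _ _ _ _ hK1 hf hM h (X + 1) (x, t) h0 XT tX.
have fB := source_growth _ _ _ hK1 hf (v (x, t)).
have {}fB : `|f (v (x, t))| <= K1 * B.
  by apply: (le_trans fB); rewrite ler_pM2l.
have {}vB : `|v (x, t)| <= B by apply: le_trans vB; rewrite lerDr.
have [z1 [z2 [d1 d2 ->]]] := parabolic_taylor phi x t h k h0 k0 dx dt dxx.
(* The intermediate points are within [h + k <= 2 * h <= d] of [(x, t)]. *)
have D1 : `|ddt phi z1 - ddt phi (x, t)| <= e by apply/phitU/(le_trans d1); lra.
have D2 : `|ddx (ddx phi) z2 - ddx (ddx phi) (x, t)| <= e.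
  by apply/phixxU/(le_trans d2); lra.
have D3 : `|phi (translate (0, k) (x, t)) - phi (x, t)| <= e.
  apply: phiU; rewrite pair_dist_le/= addr0 subrr normr0 addrAC subrr add0r.
  by rewrite (gtr0_norm k0); apply/andP; split; lra.
have cl := close _ zX; have fcl := hf (v (x, t)) (u (x, t)).
have {}fcl : `|f (v (x, t)) - f (u (x, t))| <= K1 * e.
  by apply: (le_trans fcl); rewrite ler_pM2l.
rewrite mulr1n !mul1r.
set vz := v _ in vB fB cl fcl *; set uz := u _ in cl fcl *.
set p := phi (x, t) in D3 *; set pk := phi _ in D3 *.
set qt := ddt phi (x, t) in D1 *; set qx := ddx (ddx phi) (x, t) in D2 *.
set qt1 := ddt phi z1 in D1 *; set qx2 := ddx (ddx phi) z2 in D2 *.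
(* Each summand has exactly one small factor: [vz - uz], the variation of the derivatives,
   [f vz - f uz], or the time shift of [phi]. *)
have -> : k * (uz * (- qx - qt) - f uz * p)
    - (vz * (- (k * qt1) - k * qx2) - k * f vz * pk)
  = k * ((vz - uz) * (qx + qt) + vz * ((qt1 - qt) + (qx2 - qx))
         + (f vz - f uz) * p + f vz * (pk - p)) by ring.
rewrite normrM (gtr0_norm k0) ler_pM2l//.
have E1 : `|(vz - uz) * (qx + qt)| <= e * (2 * C).
  rewrite normrM ler_pM// (le_trans (ler_normD _ _))//.
  by rewrite mulr_natl mulr2n lerD// ?phixxC ?phitC.
have E2 : `|vz * ((qt1 - qt) + (qx2 - qx))| <= B * (2 * e).
  rewrite normrM ler_pM// (le_trans (ler_normD _ _))//.
  by rewrite mulr_natl mulr2n lerD.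
have E3 : `|(f vz - f uz) * p| <= K1 * e * C by rewrite normrM ler_pM// phiC.
have E4 : `|f vz * (pk - p)| <= K1 * B * e by rewrite normrM ler_pM.
apply: (le_trans (ler_normD _ _)); apply: (le_trans (lerD (ler_normD _ _) (lexx _))).
apply: (le_trans (lerD (lerD (ler_normD _ _) (lexx _)) (lexx _))).
apply: (le_trans (lerD (lerD (lerD E1 E2) E3) E4)).
by rewrite le_eqVlt; apply/orP; left; apply/eqP; ring.
Qed.

Let trace x := u0 x * phi (x, 0).

Lemma continuous_trace : continuous trace.
Proof.
have cemb : continuous (fun x : R => (x, 0 : R)).
  move=> x; apply: (@cvg_pair _ _ _ (nbhs x) (nbhs x) (nbhs (0 : R)) _ _ _ id (fun=> 0)).
    exact: cvg_id.
  exact: cvg_cst.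
move=> x; apply: cvgM; first exact: (lipschitz_continuous _ _ _ hL x).
exact: (continuous_comp (cemb x) (cphi (x, 0))).
Qed.

Lemma trace_outside x : X < `|x| -> trace x = 0.
Proof.
by move=> xX; rewrite /trace phi0 ?mulr0// prod_normE/= lt_max xX.
Qed.

(** By the discrete identity, [k] times the difference is the integral of [residual] plus that of
    [defect]. Both are of order [k * e], so [k] cancels and the bound depends on [h] no more. *)
Lemma weak_form_error :
  `|\int[mu2]_z (upper z * weak_integrand z) - \int[mu]_x (u0 x * phi (x, 0))|
  <= e * ((2 * C + 2 * B + K1 * C + K1 * B) * (2 * (X + 1)) ^+ 2
          + M * (2 * (X + 1))).
Proof.
have [h0' kh' hd' X0' k0'] : [/\ 0 < h, k <= h, 2 * h <= d, 0 <= X & 0 < k] by [].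
have M0 : 0 <= M := le_trans (normr_ge0 _) (hM 0).
have bA : boxed (fun z => upper z * weak_integrand z).
  by apply: boxedM; [exact: loc_bounded_upper|exact: boxed_weak_integrand].
have badj := boxed_adjoint_step _ _ _ _ _ hK1 hf hM hL h phi h0 bphi.
have binit := boxed_initial _ _ hL h phi bphi.
have btr := boxed_strip k X trace (ltW k0) continuous_trace trace_outside.
have bres : boxed residual by apply: boxedB => //; exact: boxedZ.
(* On the strip [phi] is evaluated at a time in [[0, k)]; [defect] measures the change to time 0. *)
pose defect z := strip k z * u0 z.1 * phi (translate (0, k) z)
                 - strip k z * trace z.1.
have bdef : boxed defect by exact: boxedB.
have E : k * (\int[mu2]_z (upper z * weak_integrand z)
              - \int[mu]_x (u0 x * phi (x, 0)))
    = \int[mu2]_z residual z + \int[mu2]_z defect z.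
  rewrite mulrBr -(integral_strip _ _ _ (ltW k0) continuous_trace trace_outside).
  rewrite -integral_boxedZ//.
  rewrite [X in _ = X + _]integral_boxedB//; last exact: boxedZ.
  rewrite [X in _ = _ + X]integral_boxedB//.
  have := discrete_weak_identity _ _ _ _ _ hK1 hf hM hL h phi h0 bphi.
  by move=> ->; ring.
have R1 : `|\int[mu2]_z residual z|
    <= k * (e * (2 * C + 2 * B + K1 * C + K1 * B))
       * (((X + 1) - - (X + 1)) * ((X + 1) - - (X + 1))).
  apply: le_norm_integral_rectangle => //; try lra.
  move=> z rz; have : `|z| <= X + 1.
    by rewrite leNgt; apply/negP => /residual_outside r0; rewrite r0 eqxx in rz.
  by rewrite pair_norm_le !ler_norml => /andP[].
have defE z : defect z
      = strip k z * (u0 z.1 * (phi (translate (0, k) z) - phi (z.1, 0))).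
  by rewrite /defect /trace; ring.
have R2 : `|\int[mu2]_z defect z|
    <= M * e * (((X + 1) - - (X + 1)) * (0 - - k)).
  apply: le_norm_integral_rectangle => //; try lra.
  - move=> -[x t]; rewrite defE stripE ?(ltW k0)//=.
    have [/andP[t1 t2]|_] := boolP (- k <= t < 0); last first.
      by rewrite mulr0n mul0r normr0 mulr_ge0// ltW.
    rewrite mulr1n mul1r normrM ler_pM// phiU// pair_dist_le/= addr0 subrr.
    by rewrite normr0 subr0 ger0_norm; [apply/andP; split|]; lra.
  - move=> -[x t]; rewrite defE stripE ?(ltW k0)//=.
    have [/andP[t1 t2]|_] := boolP (- k <= t < 0); last first.
      by rewrite mulr0n mul0r eqxx.
    have [xX _|xX] := leP `|x| X.
      by move: xX; rewrite ler_norml => /andP[? ?]; split; apply/andP; split; lra.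
    rewrite !phi0 ?subrr ?mulr0 ?eqxx// prod_normE/= lt_max ?addr0 ?xX//.
rewrite -(ler_pM2l k0) -{1}(gtr0_norm k0) -normrM E.
apply: (le_trans (ler_normD _ _)); apply: (le_trans (lerD R1 R2)).
by rewrite le_eqVlt; apply/orP; left; apply/eqP; ring.
Qed.

End PassageToTheLimit.

Lemma test_function_support (R : realType) (phi : R * R -> R) :
  compactly_supported phi ->
  exists2 X : R, 0 <= X & forall z, X < `|z| -> phi z = 0.
Proof.
move=> /compact_bounded[N [_ bN]]; exists (`|N| + 1); first by rewrite addr_ge0.
move=> z zN; apply/eqP/negPn/negP => phiz.
have : `|z| <= `|N| + 1.
  apply: (bN (`|N| + 1)); last exact: subset_closure.
  by have := ler_norm N; lra.
by rewrite leNgt zN.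
Qed.

Theorem theorem4p1p1 (R : realType) (f u0 : R -> R)
    (K1 : R) (hK1 : 0 < K1)
    (hf : forall u v : R, `|f u - f v| <= K1 * `|u - v|)
    (M : R) (hM : 0 < M) (hu0M : forall x : R, `|u0 x| <= M)
    (L : R) (hL : 0 < L)
    (hu0L : forall x y : R, `|u0 x - u0 y| <= L * `|x - y|) :
  exists u : R * R -> R, weak_solution f u0 u.
Proof.
have [u cu lim_u] := scheme_limit _ _ _ _ _ _ hK1 hf hu0M hu0L.
exists u; split; first exact: continuous_subspaceT.
move=> phi [smooth_phi /test_function_support[X X0 phi0]].
have [cphi dx dt [cx dxx _ [cxx _ _ _ _] _] [ct _ _ _ _]] := smooth_phi 3%N.
have bphi := boxed_continuous _ _ cphi phi0.
have phit0 : forall z, X < `|z| -> ddt phi z = 0 by exact: derive_eq0_outside.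
have phixx0 : forall z, X < `|z| -> ddx (ddx phi) z = 0.
  by apply: derive_eq0_outside => z; exact: derive_eq0_outside.
have bt := boxed_continuous _ _ ct phit0.
have bxx := boxed_continuous _ _ cxx phixx0.
have [C1 C10 phiC] := boxed_bounded _ bphi.
have [C2 C20 phitC] := boxed_bounded _ bt.
have [C3 C30 phixxC] := boxed_bounded _ bxx.
pose C := C1 + C2 + C3.
pose B := sup_bound f K1 M (X + 1).
pose N := (2 * C + 2 * B + K1 * C + K1 * B) * (2 * (X + 1)) ^+ 2
          + M * (2 * (X + 1)).
pose g z := u z * (- ddx (ddx phi) z - ddt phi z) - f (u z) * phi z.
pose I := \int[(@lebesgue_measure R \x @lebesgue_measure R)%E]_z (upper z * g z).
pose J := \int[@lebesgue_measure R]_x (u0 x * phi (x, 0)).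
have error e : 0 < e -> `|I - J| <= e * N.
  move=> e0.
  have [d1 d10 phiU] := unif_continuous_boxed _ _ e cphi phi0 e0.
  have [d2 d20 phitU] := unif_continuous_boxed _ _ e ct phit0 e0.
  have [d3 d30 phixxU] := unif_continuous_boxed _ _ e cxx phixx0 e0.
  pose d := Num.min d1 (Num.min d2 d3).
  have d0 : 0 < d by rewrite !lt_min d10 d20 d30.
  (* From [h <= r] follow [2 * h <= d] and [2 * h <= 1], while [r <= e] makes the scheme [e]-close
     to [u]. *)
  pose r := Num.min e (Num.min (d / 2) (1 / 2)).
  have r0 : 0 < r by rewrite !lt_min e0 !divr_gt0.
  have [h [h0 hr close]] := lim_u (X + 1) r r0.
  have [re rd r1] : [/\ r <= e, r <= d / 2 & r <= 1 / 2].
    by split; rewrite /r !ge_min lexx ?orbT.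
  have [dd1 dd2 dd3] : [/\ d <= d1, d <= d2 & d <= d3].
    by split; rewrite /d !ge_min lexx ?orbT.
  apply: (weak_form_error _ _ _ _ _ hK1 hf hu0M hu0L u phi X cu X0 cphi ct cxx
    dx dt dxx phi0 h h0 _ C e d e0) => //.
  - lra.
  - lra.
  - by move=> z; apply: (le_trans (phiC z)); rewrite /C; lra.
  - by move=> z; apply: (le_trans (phitC z)); rewrite /C; lra.
  - by move=> z; apply: (le_trans (phixxC z)); rewrite /C; lra.
  - by move=> z z' zz'; apply: phiU; exact: le_trans zz' dd1.
  - by move=> z z' zz'; apply: phitU; exact: le_trans zz' dd2.
  - by move=> z z' zz'; apply: phixxU; exact: le_trans zz' dd3.
  - by move=> z zX; apply: (le_trans (close z zX)).
have IJ : I = J.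
  apply/eqP; rewrite -subr_eq0 -normr_eq0; apply/eqP/le_anti.
  rewrite normr_ge0 andbT; apply/ler_addgt0Pr => e e0; rewrite add0r.
  (* [N] does not depend on [e]. Dividing by [|N| + 1] avoids any discussion of its sign. *)
  have N1 : 0 < `|N| + 1 by rewrite ltr_wpDl.
  have := error (e / (`|N| + 1)) (divr_gt0 e0 N1).
  move=> /le_trans; apply; rewrite mulrAC ler_pdivrMr// ler_pM2l//.
  by have := ler_norm N; lra.
have bg : boxed (fun z => upper z * g z).
  apply: boxedM; first exact: loc_bounded_upper.
  exact: (boxed_weak_integrand _ _ hf u phi X cu cphi ct cxx phi0).
(* [I] and [J] are real parts of extended integrals; finiteness of these lifts [I = J] to the
   extended reals. *)
have iI := @integrable_fin_num _ _ _ _ _ measurableT _ (boxed_integrable _ bg).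
have iJ := @integrable_fin_num _ _ _ _ _ measurableT _
  (integrable_compact_support _ _ (continuous_trace _ _ hu0L phi cphi)
    (trace_outside u0 phi X phi0)).
rewrite integral_half_plane.
apply: (etrans (esym (fineK iI))); apply: (etrans _ (fineK iJ)).
by congr EFin.
Qed.
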